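(* Let $X$ be a random vector taking values in a real separable F-space $B$, let $\{X_j: j\ge1\}$ be i.i.d. copies of $X$, and let $t_k:B\to\mathbb{R}$, $k\ge1$, be Borel measurable functionals such that $\{t_k(X):k\ge1\}$ are independent mean zero random variables with variances $\sigma_k^2\in(0,\infty)$, $k\ge1$. Assume that for every real sequence $\{c_k:k\ge1\}$ with $\lim_{k\to\infty}c_k/\sigma_k=0$, $$\liminf_{k\to\infty}P(t_k(X)<c_k)>0,$$ and let $\mathcal{T}$ be a collection of Borel measurable functionals on $B$ with $\mathcal{T}\supseteq\{t_k:k\ge1\}$. Then for all $n\ge1$ and all $a\in B$ with $$\lim_{k\to\infty}\frac{t_k(a)}{\sigma_k}=0,$$ the empirical half space depth satisfies $$HD_{\mathcal{T}}(a,\mu_n)\equiv\inf_{t\in\mathcal{T}}\frac1n\sum_{j=1}^nI(t(X_j)\ge t(a))=0$$ with probability one.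
   Context: A real separable F-space is a real topological vector space whose topology is induced by a complete, separable, translation invariant metric; it carries its Borel sigma-field. All random vectors are defined on a probability space $(\Omega,\mathcal{F},P)$ and are Borel measurable. $\mu_n=\frac1n\sum_{j=1}^n\delta_{X_j}$ is the empirical measure. $I(\cdot)$ denotes an indicator function. *)

(* Defs.v *)
From HB Require Import structures.
From mathcomp Require Import all_boot all_order all_algebra finmap.
From mathcomp Require Import interval_inference.
From mathcomp Require Import all_classical all_reals all_analysis.

Set Implicit Arguments.
Unset Strict Implicit.
Unset Printing Implicit Defensive.

Import Order.TTheory GRing.Theory Num.Theory.
Import numFieldTopology.Exports numFieldNormedType.Exports.

Local Open Scope classical_set_scope.
Local Open Scope ring_scope.

Section separable_Fspace.
Context (R : realType) (B : topologicalLmodType R).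

Record is_metric (rho : B -> B -> R) : Prop := IsMetric {
  metric_eq0 : forall x y, rho x y = 0 <-> x = y ;
  metric_symmetric : forall x y, rho x y = rho y x ;
  metric_triangular : forall x y z, rho x z <= rho x y + rho y z
}.

Definition induces_topology (rho : B -> B -> R) : Prop :=
  forall (x : B) (U : set B),
    nbhs x U <-> exists2 e : R, 0 < e & [set y | rho x y < e] `<=` U.

Definition translation_invariant (rho : B -> B -> R) : Prop :=
  forall x y z : B, rho (x + z) (y + z) = rho x y.

Definition complete_metric (rho : B -> B -> R) : Prop :=
  forall u : nat -> B,
    (forall e : R, 0 < e -> exists N : nat, forall m n : nat,
      (N <= m)%N -> (N <= n)%N -> rho (u m) (u n) < e) ->
    exists l : B, rho (u n) l @[n --> \oo] --> (0 : R).

Definition separable_metric (rho : B -> B -> R) : Prop :=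
  exists2 D : set B, countable D &
    forall (x : B) (e : R), 0 < e -> exists2 y, D y & rho x y < e.

(* The library's [tvsType] is not used because it includes local convexity. *)
Definition separable_Fspace : Prop :=
  exists rho : B -> B -> R, [/\ is_metric rho, induces_topology rho,
    translation_invariant rho, complete_metric rho & separable_metric rho].

End separable_Fspace.

(* [g_sigma_algebraType] yields a measurable type only over a pointed type. *)
Definition pointed_lmod (R : realType) (B : topologicalLmodType R) : Type := B.

HB.instance Definition _ (R : realType) (B : topologicalLmodType R) :=
  Choice.on (pointed_lmod B).
HB.instance Definition _ (R : realType) (B : topologicalLmodType R) :=
  isPointed.Build (pointed_lmod B) (0 : B).

Definition borel (R : realType) (B : topologicalLmodType R) :=
  g_sigma_algebraType (@open B : set (set (pointed_lmod B))).

Section probability_notions.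
Context d (Omega : measurableType d) (R : realType) (P : probability Omega R).

Definition mutually_independent d' (S : measurableType d') (I : choiceType)
    (Y : I -> {RV P >-> S}) : Prop :=
  forall (J : {fset I}) (A : I -> set S), (forall i, measurable (A i)) ->
    P (\bigcap_(i in [set` J]) (Y i @^-1` A i)) =
    (\prod_(i <- J) P (Y i @^-1` A i))%E.

(* Equality is required on measurable sets only: the value of a measure on a
   non-measurable set is unconstrained. *)
Definition same_law d' (S : measurableType d') (Y Z : {RV P >-> S}) : Prop :=
  forall A : set S, measurable A -> distribution P Y A = distribution P Z A.

Definition iid_copies d' (S : measurableType d') (Y : {RV P >-> S})
    (Ys : nat -> {RV P >-> S}) : Prop :=
  mutually_independent Ys /\ forall j, same_law (Ys j) Y.

End probability_notions.

Arguments mutually_independent {d Omega R} P {d' S I} Y.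
Arguments iid_copies {d Omega R} P {d' S} Y Ys.

Definition empirical_measure d d' (Omega : measurableType d)
    (S : measurableType d') (R : realType) (Ys : nat -> Omega -> S) (n : nat)
    (w : Omega) : {measure set S -> \bar R} :=
  mscale (n%:R^-1)%:nng (msum (fun j => \d_(Ys j w)) n).

Definition halfspace_depth d (S : measurableType d) (R : realType)
    (T : set {mfun S >-> R}) (a : S) (Q : {measure set S -> \bar R}) : \bar R :=
  ereal_inf [set Q [set x | t a <= t x] | t in T].

Lemma halfspace_depth_empiricalE d d' (Omega : measurableType d)
    (S : measurableType d') (R : realType) (T : set {mfun S >-> R})
    (Ys : nat -> Omega -> S) (n : nat) (a : S) (w : Omega) :
  halfspace_depth T a (empirical_measure R Ys n w) =
  ereal_inf [set (n%:R^-1 * \sum_(j < n) (t a <= t (Ys j w))%R%:R)%:E | t in T].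
Proof.
rewrite /halfspace_depth; congr ereal_inf; apply: eq_imagel => t _.
rewrite /= /mscale /msum /= EFinM -sumEFin; congr (_ * _)%E.
apply: eq_bigr => j _; rewrite /= /dirac /indic; congr (_%:R%:E).
by congr nat_of_bool; apply/idP/idP; rewrite inE.
Qed.

(* Main.v *)
(* Fix [a] and [n]. If some [k] satisfies [t k (Xs j w) < t k a] for all
   [j < n], then the half space of [t k] through [a] contains no data point, so
   the depth is [0]. Since [Xs] is i.i.d. and the [t k \o X] are independent,
   these events are independent in [k] with probabilities [p k ^ n], where
   [p k = P(t k X < t k a)] is eventually bounded away from [0] by the
   hypothesis applied to [c k = t k a]. Hence almost surely one of them
   occurs. *)
Require Import Defs.
From HB Require Import structures.
From mathcomp Require Import all_boot all_order all_algebra finmap.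
From mathcomp Require Import interval_inference.
From mathcomp Require Import all_classical all_reals all_analysis.

Import Order.TTheory GRing.Theory Num.Theory.
Import numFieldTopology.Exports numFieldNormedType.Exports.

Local Open Scope classical_set_scope.
Local Open Scope ring_scope.

(** The limit inferior is the supremum of the tail infima, so one tail infimum already exceeds [l];
    it serves as [m]. *)
Lemma limn_einf_gt_exists (R : realType) (u : (\bar R)^nat) (l : \bar R) :
  (l < limn_einf u)%E ->
  exists (N : nat) (m : \bar R),
    (l < m)%E /\ forall k, (N <= k)%N -> (m <= u k)%E.
Proof.
rewrite limn_einf_lim (cvg_lim (@ereal_hausdorff R) (@cvg_einfs_sup R u)).
move=> /ereal_sup_gt[_ [N _ <-] lN]; exists N, (einfs u N); split=> // k Nk.
by apply: ereal_inf_lbound; exists k.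
Qed.

Section independent_events.
Context {d : measure_display} {T : measurableType d} {R : realType}.
Variables (P : probability T R) (E : nat -> set T) (q : nat -> R).
Hypothesis mE : forall i, measurable (E i).
Hypothesis indepE : forall J : {fset nat},
  P (\bigcap_(i in [set` J]) E i) = (\prod_(i <- J) q i)%:E.

(** Induction on [m]: removing [E m] from an event subtracts the part inside [E m], and that part
    has the same form with [m] adjoined to [L]. Hence [L] must be arbitrary, and its lower bound
    ensures that the adjoined index is new. *)
Lemma independent_events_setC (m : nat) (L : {fset nat}) :
  (forall i, i \in L -> (m <= i)%N) ->
  P (\bigcap_(i in [set` L]) E i `&` \bigcap_(i < m) ~` E i) =
  (\prod_(i <- L) q i * \prod_(i < m) (1 - q i))%:E.
Proof.
elim: m L => [|m IH] L Lm.
  by rewrite big_ord0 mulr1 bigcap_mkord big_ord0 setIT indepE.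
have mL : m \notin L by apply/negP => /Lm; rewrite ltnn.
have mC (K : {fset nat}) :
    measurable (\bigcap_(i in [set` K]) E i `&` \bigcap_(i < m) ~` E i).
  apply: measurableI; first by apply: fin_bigcap_measurable.
  by apply: bigcap_measurableType => i _; exact: measurableC.
have -> : \bigcap_(i in [set` L]) E i `&` \bigcap_(i < m.+1) ~` E i =
    (\bigcap_(i in [set` L]) E i `&` \bigcap_(i < m) ~` E i) `\` E m.
  by rewrite !bigcap_mkord big_ord_recr /= setIA setDE.
rewrite measureD //; last first.
  by rewrite (le_lt_trans (probability_le1 P (mC _))) ?ltry.
have -> : \bigcap_(i in [set` L]) E i `&` \bigcap_(i < m) ~` E i `&` E m =
    \bigcap_(i in [set` (m |` L)%fset]) E i `&` \bigcap_(i < m) ~` E i.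
  by rewrite bigcap_fsetU1 setIC setIA.
rewrite [X in (X - _)%E]IH; last by move=> i /Lm/ltnW.
rewrite [X in (_ - X)%E]IH; last first.
  by move=> i; rewrite in_fset1U => /orP[/eqP->|/Lm/ltnW].
rewrite big_fsetU1 //= -EFinB big_ord_recr /=; congr EFin.
by rewrite mulrBr mulr1 mulrBr -mulrA [q m * _]mulrC mulrA.
Qed.

(** The divergence half of Borel-Cantelli in geometric form: among the first [N + m] complements,
    the last [m] contribute a factor of at most [1 - e] each. *)
Lemma independent_events_bigcap_setC0 (e : R) (N : nat) :
  0 < e -> (forall i, (N <= i)%N -> e <= q i) -> P (\bigcap_i ~` E i) = 0.
Proof.
move=> e0 le_eq.
(* Independence over a singleton identifies [q i] with the probability of [E i]. *)
have q01 i : 0 <= q i <= 1.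
  have := indepE [fset i]%fset; rewrite set_fset1 bigcap_set1 big_seq_fset1.
  by move=> qE; rewrite -!lee_fin -qE measure_ge0 probability_le1.
have e1 : e <= 1 by rewrite (le_trans (le_eq N _))//; case/andP: (q01 N).
have mbad : measurable (\bigcap_i ~` E i).
  by apply: bigcap_measurableType => i _; exact: measurableC.
have bound m : fine (P (\bigcap_i ~` E i)) <= (1 - e) ^+ m.
  have := @independent_events_setC (N + m) fset0.
  rewrite big_seq_fset0 mul1r bigcap_fset big_seq_fset0 setTI => PE.
  rewrite -lee_fin fineK ?fin_num_measure//.
  apply: (@le_trans _ _ (P (\bigcap_(i < N + m) ~` E i))).
    apply: le_measure; rewrite ?inE //.
    - by apply: bigcap_measurableType => i _; exact: measurableC.
    - by move=> w badw i _; exact: badw.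
  rewrite PE // lee_fin big_split_ord /= -[leRHS]mul1r.
  have q1 i : 0 <= 1 - q i <= 1.
    by case/andP: (q01 i) => ? ?; rewrite subr_ge0 lerBlDr lerDl; apply/andP.
  apply: ler_pM.
  - by apply: prodr_ge0 => i _; case/andP: (q1 i).
  - by apply: prodr_ge0 => i _; case/andP: (q1 (N + i)%N).
  - by apply: prodr_ile1 => i _; exact: q1.
  - rewrite -[X in _ ^+ X]card_ord -prodr_const; apply: ler_prod => i _.
    by case/andP: (q1 (N + i)%N) => -> _; rewrite lerD2l lerN2 le_eq ?leq_addr.
have lim0 : ((1 - e) ^+ m @[m --> \oo] --> (0 : R)).
  by apply: cvg_expr; rewrite ger0_norm ?subr_ge0 // ltrBlDr ltrDl.
rewrite -[LHS]fineK ?fin_num_measure//; congr EFin; apply/eqP.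
rewrite eq_le fine_ge0 // andbT -(cvg_lim (@Rhausdorff R) lim0).
apply: limr_ge; first by apply/cvg_ex; exists 0.
by apply: nearW => m; exact: bound.
Qed.

End independent_events.

(** Swapping the intersections gives, for each [j < n], the event that [Ys j] lies in all [A k] with
    [k] in [J]. These events are independent in [j], each with the probability known for [Y]. *)
Lemma iid_preimage_bigcap d (Omega : measurableType d) (R : realType)
    (P : probability Omega R) d' (S : measurableType d') (Y : {RV P >-> S})
    (Ys : nat -> {RV P >-> S}) (A : nat -> set S) (p : nat -> R)
    (n : nat) :
  iid_copies P Y Ys -> (forall k, measurable (A k)) ->
  (forall J : {fset nat},
    P (\bigcap_(k in [set` J]) (Y @^-1` A k)) = (\prod_(k <- J) p k)%:E) ->
  forall J : {fset nat},
    P (\bigcap_(k in [set` J]) \bigcap_(j < n) (Ys j @^-1` A k)) =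
    (\prod_(k <- J) p k ^+ n)%:E.
Proof.
move=> [indYs lawYs] mA indA J.
pose AJ := \bigcap_(k in [set` J]) A k.
pose Jn := [fset j in iota 0 n]%fset.
have mAJ : measurable AJ by apply: fin_bigcap_measurable.
have -> : \bigcap_(k in [set` J]) \bigcap_(j < n) (Ys j @^-1` A k) =
    \bigcap_(j in [set` Jn]) (Ys j @^-1` AJ).
  rewrite /AJ; apply/seteqP; split => w /= h.
  - move=> j /=; rewrite in_fset /= mem_iota /= add0n => jn k kJ.
    exact: h k kJ j jn.
  - move=> k kJ j /= jn; apply: (h j _ k kJ) => /=.
    by rewrite in_fset /= mem_iota add0n.
rewrite (indYs Jn (fun=> AJ)) //.
(* Independence in [k] is assumed for [Y] only; equality of laws on the whole set [AJ] transfers it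
   to [Ys j]. *)
have PAJ j : P (Ys j @^-1` AJ) = (\prod_(k <- J) p k)%:E.
  by rewrite -indA -preimage_bigcap -[LHS]/(distribution P (Ys j) AJ) lawYs.
transitivity (\prod_(j <- Jn) (\prod_(k <- J) p k)%:E)%E.
  by apply: eq_bigr => j _; exact: PAJ.
rewrite prodEFin; congr EFin; rewrite prodrXl.
rewrite big_const_seq count_predT iter_mulr_1; congr (_ ^+ _).
by rewrite card_fseq undup_id ?iota_uniq // size_iota.
Qed.

Theorem theorem3 (R : realType) (d : measure_display) (Omega : measurableType d)
    (P : probability Omega R) (B : topologicalLmodType R)
    (X : {RV P >-> borel B}) (Xs : nat -> {RV P >-> borel B})
    (t : nat -> {mfun borel B >-> R}) (sigma : nat -> R)
    (T : set {mfun borel B >-> R}) :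
  separable_Fspace B ->
  iid_copies P X Xs ->
  mutually_independent P (fun k => t k \o X : {RV P >-> R}) ->
  (forall k, P.-integrable [set: Omega] (EFin \o (t k \o X))) ->
  (forall k, 'E_P[t k \o X] = 0)%E ->
  (forall k, 0 < sigma k) ->
  (forall k, 'V_P[t k \o X] = (sigma k ^+ 2)%:E) ->
  (forall c : nat -> R, c k / sigma k @[k --> \oo] --> (0 : R) ->
    (0 < limn_einf (fun k => P [set w | (t k (X w) < c k)%R]))%E) ->
  (forall k, T (t k)) ->
  forall (n : nat) (a : B), (0 < n)%N ->
    t k a / sigma k @[k --> \oo] --> (0 : R) ->
    {ae P, forall w, halfspace_depth T a (empirical_measure R Xs n w) = 0%E}.
Proof.
move=> _ iidXs indt _ _ _ _ tlt Tt n a n0 ta0.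
pose A k : set (borel B) := t k @^-1` `]-oo, t k a[.
have mA k : measurable (A k) by rewrite -[A k]setTI; exact: measurable_funPT.
pose p k : R := fine (P (X @^-1` A k)).
have mXA (Y : {RV P >-> borel B}) k : measurable (Y @^-1` A k).
  by rewrite -[X in measurable X]setTI; exact: measurable_funPT.
have pE k : P (X @^-1` A k) = (p k)%:E by rewrite fineK ?fin_num_measure.
have indA (J : {fset nat}) :
    P (\bigcap_(k in [set` J]) (X @^-1` A k)) = (\prod_(k <- J) p k)%:E.
  rewrite (indt J (fun k => [set` `]-oo, t k a[%R])) //.
  by rewrite -prodEFin; apply: eq_bigr => k _; rewrite -pE.
have [N [e [e0 eP]]] := limn_einf_gt_exists _ _ _ (tlt _ ta0).
have XAE k : X @^-1` A k = [set w | t k (X w) < t k a].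
  by apply/seteqP; split=> w /=; rewrite /A /= in_itv.
have eP' k : (N <= k)%N -> (e <= (p k)%:E)%E.
  by move=> Nk; rewrite -pE XAE; exact: eP.
(* The bound [e] is an extended real; lying below the probability [p N] makes it finite. *)
have efin : e \is a fin_num.
  rewrite ge0_fin_numE ?(ltW e0) //.
  by rewrite (le_lt_trans (eP' N _)) // ltry.
pose E k := \bigcap_(j < n) (Xs j @^-1` A k).
(* The exceptional null set: no [t k] has all [n] data points strictly below level [t k a]. *)
exists (\bigcap_k ~` E k); split.
- apply: bigcap_measurableType => k _; apply: measurableC.
  by apply: bigcap_measurableType => j _; exact: mXA.
- apply: (@independent_events_bigcap_setC0 _ _ _ P E (fun k => p k ^+ n) _ _
    (fine e ^+ n) N).
  + by move=> k; apply: bigcap_measurableType => j _; exact: mXA.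
  + exact: iid_preimage_bigcap iidXs mA indA.
  + by rewrite exprn_gt0 // fine_gt0 // e0 ltey_eq efin.
  + move=> k Nk.
    have epk : fine e <= p k by rewrite -lee_fin fineK // eP'.
    have e_ge0 : 0 <= fine e by rewrite fine_ge0 // ltW.
    by apply: lerXn2r; rewrite // nnegrE // (le_trans e_ge0).
(* By contraposition: a single [E k] containing [w] forces depth zero, since the term of [t k] in
   the infimum vanishes and all terms are nonnegative. *)
- move=> w /= depth_neq0 k _ Ekw; apply: depth_neq0.
  rewrite halfspace_depth_empiricalE; apply/eqP; rewrite eq_le.
  apply/andP; split.
  + apply: ereal_inf_lbound; exists (t k); first exact: Tt.
    rewrite big1 ?mulr0 // => j _; have := Ekw j (ltn_ord j).
    by rewrite /A /= in_itv /= ltNge => /negbTE ->.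
  + apply: le_ereal_inf_tmp => _ [s _ <-].
    rewrite lee_fin mulr_ge0 ?invr_ge0 //.
    by apply: sumr_ge0.
Qed.
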